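(* Let $J\colon\mathcal A\to\mathcal E$ be a pseudofunctor between bicategories and let $T$ be a $J$-relative pseudomonad. The forgetful pseudofunctor $U_T\colon\mathrm{PsAlg}(T)\to\mathcal E$ admits a left $J$-relative pseudoadjoint $F_T\colon\mathcal A\to\mathrm{PsAlg}(T)$. Furthermore, this relative pseudoadjunction induces $T$ (that is, the $J$-relative pseudomonad it induces is exactly $T$).
   Context: Conventions. For a bicategory $\mathcal E$, $\mathcal E[X,Y]$ is the hom-category; composition of 1-cells and whiskering are written by juxtaposition, vertical composition of 2-cells by $\circ$; structural isomorphisms (associators, unitors, pseudofunctor constraints) are left implicit in equations or written $\cong$. A $J$-relative pseudomonad $T$ comprises: an object $TX\in\mathcal E$ for each $X\in\mathcal A$; functors $(-)^*\colon\mathcal E[JX,TY]\to\mathcal E[TX,TY]$ for $X,Y\in\mathcal A$; 1-cells $i_X\colon JX\to TX$; invertible 2-cells $\mu_{g,f}\colon(g^*f)^*\Rightarrow g^*f^*$ natural in $f\colon JX\to TY$, $g\colon JY\to TZ$; invertible 2-cells $\eta_f\colon f\Rightarrow f^*i_X$ natural in $f\colon JX\to TY$; invertible 2-cells $\theta_X\colon(i_X)^*\Rightarrow 1_{TX}$; such that $(\mu_{h,g}f^* )\circ\mu_{h^*g,f}=(h^*\mu_{g,f})\circ\mu_{h,g^*f}\circ(\mu_{h,g}f)^*$ for all $f\colon JW\to TX$, $g\colon JX\to TY$, $h\colon JY\to TZ$, and $(f^*\theta_X)\circ\mu_{f,i_X}\circ(\eta_f)^*$ is the structural isomorphism $f^*\cong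 f^*1_{TX}$ for all $f\colon JX\to TY$. A $T$-pseudoalgebra $(A,(-)^a,\hat a,\tilde a)$ comprises: an object $A\in\mathcal E$; functors $(-)^a\colon\mathcal E[JX,A]\to\mathcal E[TX,A]$ for $X\in\mathcal A$; invertible 2-cells $\hat a_{g,f}\colon(g^af)^a\Rightarrow g^af^*$ natural in $f\colon JX\to TY$, $g\colon JY\to A$; invertible 2-cells $\tilde a_f\colon f\Rightarrow f^ai_X$ natural in $f\colon JX\to A$; such that $(\hat a_{h,g}f^* )\circ\hat a_{h^ag,f}=(h^a\mu_{g,f})\circ\hat a_{h,g^*f}\circ(\hat a_{h,g}f)^a$ for all $f\colon JX\to TY$, $g\colon JY\to TZ$, $h\colon JZ\to A$, and $(f^a\theta_X)\circ\hat a_{f,i_X}\circ(\tilde a_f)^a$ is the structural isomorphism $f^a\cong f^a1_{TX}$ for all $f\colon JX\to A$. A pseudomorphism $(h,\overline h)\colon(A,(-)^a,\hat a,\tilde a)\to(B,(-)^b,\hat b,\tilde b)$ comprises a 1-cell $h\colon A\to B$ and invertible 2-cells $\overline h_f\colon(hf)^b\Rightarrow hf^a$ natural in $f\colon JX\to A$ such that $(h\hat a_{g,f})\circ\overline h_{g^af}\circ(\overline h_gf)^b=(\overline h_gf^* )\circ\hat b_{hg,f}$ for all $f\colon JX\to TY$, $g\colon JY\to A$, and $(\overline h_fi_X)\circ\tilde b_{hf}=h\tilde a_f$ for all $f\colon JX\to A$. A transformation $(h,\overline h)\Rightarrow(h',\overline{h'})$ is a 2-cell $\alpha\colon h\Rightarrow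 h'$ with $\overline{h'}_f\circ(\alpha f)^b=(\alpha f^a)\circ\overline h_f$ for all $f\colon JX\to A$. These form the bicategory $\mathrm{PsAlg}(T)$: the identity on $A$ is $1_A$ with $(1_Af)^a\cong f^a\cong 1_Af^a$; the composite of $(h,\overline h)\colon A\to B$ and $(h',\overline{h'})\colon B\to C$ is $h'h$ with $((h'h)f)^c\cong(h'(hf))^c\xrightarrow{\overline{h'}_{hf}}h'(hf)^b\xrightarrow{h'\overline h_f}h'(hf^a)\cong(h'h)f^a$; the remaining structure is that of $\mathcal E$. The strict pseudofunctor $U_T\colon\mathrm{PsAlg}(T)\to\mathcal E$ sends $(A,(-)^a,\hat a,\tilde a)\mapsto A$, $(h,\overline h)\mapsto h$, $\alpha\mapsto\alpha$. A $J$-relative pseudoadjunction $(L,R,i,\sharp,\eta,\varepsilon)$ ($L$ is a left $J$-relative pseudoadjoint of $R$) comprises: a pseudofunctor $R\colon\mathcal C\to\mathcal E$; an object $LX\in\mathcal C$ and a 1-cell $i_X\colon JX\to RLX$ for each $X\in\mathcal A$; and for all $X\in\mathcal A$, $Y\in\mathcal C$ an adjoint equivalence with left adjoint $(-)^\sharp\colon\mathcal E[JX,RY]\to\mathcal C[LX,Y]$ and right adjoint $R(-)i_X$, with unit $\eta_f\colon f\Rightarrow R(f^\sharp)i_X$ and counit $\varepsilon_h\colon(R(h)i_X)^\sharp\Rightarrow h$. The assignment $L$ then extends to a pseudofunctor $\mathcal A\to\mathcal C$ with $L(f)=(i_Y\,Jf)^\sharp$. The relative pseudoadjunction induces a $J$-relative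 pseudomonad with action on objects $X\mapsto RLX$, extension operator $f^*=R(f^\sharp)$, unit $i$, 2-cells $\eta$, $\mu_{g,f}\colon R((R(g^\sharp)f)^\sharp)\xrightarrow{R((R(g^\sharp)\eta_f)^\sharp)}R((R(g^\sharp)R(f^\sharp)i_X)^\sharp)\cong R((R(g^\sharp f^\sharp)i_X)^\sharp)\xrightarrow{R(\varepsilon)}R(g^\sharp f^\sharp)\cong R(g^\sharp)R(f^\sharp)$, and $\theta_X\colon R((i_X)^\sharp)\cong R((R(1_{LX})i_X)^\sharp)\xrightarrow{R(\varepsilon)}R(1_{LX})\cong 1_{RLX}$. *)

(* Defs.v *)
From Stdlib Require Import ssreflect ProofIrrelevance.

Set Implicit Arguments.
Unset Strict Implicit.
Unset Printing Implicit Defensive.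

Record Category := {
  obj :> Type;
  mor : obj -> obj -> Type;
  idm : forall a, mor a a;
  vcomp : forall a b c, mor b c -> mor a b -> mor a c;
  vcompA : forall a b c d (z : mor c d) (y : mor b c) (x : mor a b),
    vcomp (vcomp z y) x = vcomp z (vcomp y x);
  vcomp1m : forall a b (x : mor a b), vcomp (idm b) x = x;
  vcompm1 : forall a b (x : mor a b), vcomp x (idm a) = x
}.
Arguments mor {_} _ _.
Arguments idm {_} a.
Arguments vcomp {_ _ _ _} _ _.

Notation "a ⇒ b" := (mor a b) (at level 70, no associativity).
Notation "y ∘ x" := (vcomp y x) (at level 51, right associativity).

Record Iso (C : Category) (a b : C) := {
  iso_mor :> a ⇒ b;
  iso_inv : b ⇒ a;
  iso_invK : iso_inv ∘ iso_mor = idm a;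
  iso_morK : iso_mor ∘ iso_inv = idm b
}.
Notation "a ≅ b" := (Iso a b) (at level 70, no associativity).

#[projections(primitive)]
Record Functor (C D : Category) := {
  fobj :> C -> D;
  fmap : forall a b : C, a ⇒ b -> fobj a ⇒ fobj b;
  fmap1 : forall a, fmap (idm a) = idm (fobj a);
  fmapM : forall a b c (y : b ⇒ c) (x : a ⇒ b), fmap (y ∘ x) = fmap y ∘ fmap x
}.
Arguments fmap {C D} _ {a b} _.

Section IsoOps.
Variable C : Category.

Definition isoV (a b : C) (u : a ≅ b) : b ≅ a :=
  {| iso_mor := iso_inv u; iso_inv := u;
     iso_invK := iso_morK u; iso_morK := iso_invK u |}.

Lemma iso_comp_invK (a b c : C) (v : b ≅ c) (u : a ≅ b) :
  (iso_inv u ∘ iso_inv v) ∘ (v ∘ u) = idm a.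
Proof. by rewrite vcompA -(vcompA (iso_inv v)) iso_invK vcomp1m iso_invK. Qed.

Lemma iso_comp_morK (a b c : C) (v : b ≅ c) (u : a ≅ b) :
  (v ∘ u) ∘ (iso_inv u ∘ iso_inv v) = idm c.
Proof. by rewrite vcompA -(vcompA u) iso_morK vcomp1m iso_morK. Qed.

Definition iso_comp (a b c : C) (v : b ≅ c) (u : a ≅ b) : a ≅ c :=
  {| iso_mor := v ∘ u; iso_inv := iso_inv u ∘ iso_inv v;
     iso_invK := iso_comp_invK v u; iso_morK := iso_comp_morK v u |}.

Definition iso_id (a : C) : a ≅ a :=
  {| iso_mor := idm a; iso_inv := idm a;
     iso_invK := vcomp1m (idm a); iso_morK := vcomp1m (idm a) |}.

End IsoOps.

Section FunctorOps.
Variables (C D : Category) (F : Functor C D).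

Lemma fmap_iso_invK (a b : C) (u : a ≅ b) :
  fmap F (iso_inv u) ∘ fmap F u = idm (F a).
Proof. by rewrite -fmapM iso_invK fmap1. Qed.

Lemma fmap_iso_morK (a b : C) (u : a ≅ b) :
  fmap F u ∘ fmap F (iso_inv u) = idm (F b).
Proof. by rewrite -fmapM iso_morK fmap1. Qed.

Definition fmap_iso (a b : C) (u : a ≅ b) : F a ≅ F b :=
  {| iso_mor := fmap F u; iso_inv := fmap F (iso_inv u);
     iso_invK := fmap_iso_invK u; iso_morK := fmap_iso_morK u |}.

End FunctorOps.

Section FunctorComp.
Variables (B C D : Category) (G : Functor C D) (F : Functor B C).

Lemma fcomp_map1 (a : B) : fmap G (fmap F (idm a)) = idm (G (F a)).
Proof. by rewrite !fmap1. Qed.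

Lemma fcomp_mapM (a b c : B) (y : b ⇒ c) (x : a ⇒ b) :
  fmap G (fmap F (y ∘ x)) = fmap G (fmap F y) ∘ fmap G (fmap F x).
Proof. by rewrite !fmapM. Qed.

Definition fcomp : Functor B D :=
  {| fobj := fun a => G (F a); fmap := fun a b x => fmap G (fmap F x);
     fmap1 := fcomp_map1; fmapM := fcomp_mapM |}.

End FunctorComp.

Definition fid (C : Category) : Functor C C :=
  {| fobj := fun a => a; fmap := fun a b x => x;
     fmap1 := fun a => eq_refl; fmapM := fun a b c y x => eq_refl |}.

Record AdjointEquivalence (C D : Category) (G : Functor D C) := {
  ladj : Functor C D;
  aunit : forall a : C, a ≅ G (ladj a);
  acounit : forall b : D, ladj (G b) ≅ b;
  aunit_nat : forall (a a' : C) (x : a ⇒ a'),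
    aunit a' ∘ x = fmap G (fmap ladj x) ∘ aunit a;
  acounit_nat : forall (b b' : D) (y : b ⇒ b'),
    acounit b' ∘ fmap ladj (fmap G y) = y ∘ acounit b;
  atriangle_l : forall a : C, acounit (ladj a) ∘ fmap ladj (aunit a) = idm (ladj a);
  atriangle_r : forall b : D, fmap G (acounit b) ∘ aunit (G b) = idm (G b)
}.

(** Homs are categories with Leibniz equality of 2-cells.  Horizontal composition
    is presented by the two whiskerings and the interchange law; [g · f] is "g
    after f". *)
Record Bicategory := {
  cell0 :> Type;
  hom : cell0 -> cell0 -> Category;
  id1 : forall X, hom X X;
  comp1 : forall X Y Z, hom Y Z -> hom X Y -> hom X Z;
  lwhisk : forall X Y Z (g : hom Y Z) (f f' : hom X Y),
    f ⇒ f' -> comp1 g f ⇒ comp1 g f';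
  rwhisk : forall X Y Z (g g' : hom Y Z),
    g ⇒ g' -> forall f : hom X Y, comp1 g f ⇒ comp1 g' f;
  assoc : forall W X Y Z (h : hom Y Z) (g : hom X Y) (f : hom W X),
    comp1 (comp1 h g) f ≅ comp1 h (comp1 g f);
  lunit : forall X Y (f : hom X Y), comp1 (id1 Y) f ≅ f;
  runit : forall X Y (f : hom X Y), comp1 f (id1 X) ≅ f;
  lwhisk1 : forall X Y Z (g : hom Y Z) (f : hom X Y),
    lwhisk g (idm f) = idm (comp1 g f);
  lwhiskM : forall X Y Z (g : hom Y Z) (f f' f'' : hom X Y)
      (y : f' ⇒ f'') (x : f ⇒ f'),
    lwhisk g (y ∘ x) = lwhisk g y ∘ lwhisk g x;
  rwhisk1 : forall X Y Z (g : hom Y Z) (f : hom X Y),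
    rwhisk (idm g) f = idm (comp1 g f);
  rwhiskM : forall X Y Z (g g' g'' : hom Y Z)
      (y : g' ⇒ g'') (x : g ⇒ g') (f : hom X Y),
    rwhisk (y ∘ x) f = rwhisk y f ∘ rwhisk x f;
  interchange : forall X Y Z (g g' : hom Y Z) (f f' : hom X Y)
      (y : g ⇒ g') (x : f ⇒ f'),
    rwhisk y f' ∘ lwhisk g x = lwhisk g' x ∘ rwhisk y f;
  assoc_natl : forall W X Y Z (h h' : hom Y Z) (g : hom X Y) (f : hom W X)
      (z : h ⇒ h'),
    assoc h' g f ∘ rwhisk (rwhisk z g) f = rwhisk z (comp1 g f) ∘ assoc h g f;
  assoc_natm : forall W X Y Z (h : hom Y Z) (g g' : hom X Y) (f : hom W X)
      (y : g ⇒ g'),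
    assoc h g' f ∘ rwhisk (lwhisk h y) f = lwhisk h (rwhisk y f) ∘ assoc h g f;
  assoc_natr : forall W X Y Z (h : hom Y Z) (g : hom X Y) (f f' : hom W X)
      (x : f ⇒ f'),
    assoc h g f' ∘ lwhisk (comp1 h g) x = lwhisk h (lwhisk g x) ∘ assoc h g f;
  lunit_nat : forall X Y (f f' : hom X Y) (x : f ⇒ f'),
    lunit f' ∘ lwhisk (id1 Y) x = x ∘ lunit f;
  runit_nat : forall X Y (f f' : hom X Y) (x : f ⇒ f'),
    runit f' ∘ rwhisk x (id1 X) = x ∘ runit f;
  pentagon : forall V W X Y Z (k : hom Y Z) (h : hom X Y) (g : hom W X) (f : hom V W),
    assoc k h (comp1 g f) ∘ assoc (comp1 k h) g f
    = lwhisk k (assoc h g f) ∘ assoc k (comp1 h g) f ∘ rwhisk (assoc k h g) f;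
  triangle : forall X Y Z (g : hom Y Z) (f : hom X Y),
    lwhisk g (lunit f) ∘ assoc g (id1 Y) f = rwhisk (runit g) f
}.
Arguments hom {b} _ _.
Arguments id1 {b} X.
Arguments comp1 {b X Y Z} _ _.
Arguments lwhisk {b X Y Z} g {f f'} _.
Arguments rwhisk {b X Y Z} {g g'} _ f.
Arguments assoc {b W X Y Z} h g f.
Arguments lunit {b X Y} f.
Arguments runit {b X Y} f.

Notation "g · f" := (comp1 g f) (at level 40, left associativity).
Notation "g ◁ x" := (lwhisk g x) (at level 42, right associativity).
Notation "y ▷ f" := (rwhisk y f) (at level 43, left associativity).

Section BicategoryOps.
Variable E : Bicategory.

Definition postcomp (X Y Z : E) (g : hom Y Z) : Functor (hom X Y) (hom X Z) :=
  {| fobj := fun f => g · f; fmap := fun f f' x => g ◁ x;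
     fmap1 := lwhisk1 g; fmapM := fun f f' f'' y x => lwhiskM g y x |}.

Definition precomp (X Y Z : E) (f : hom X Y) : Functor (hom Y Z) (hom X Z) :=
  {| fobj := fun g => g · f; fmap := fun g g' y => y ▷ f;
     fmap1 := fun g => rwhisk1 g f; fmapM := fun g g' g'' y x => rwhiskM y x f |}.

Definition lwhisk_iso (X Y Z : E) (g : hom Y Z) (f f' : hom X Y) (u : f ≅ f') :
  g · f ≅ g · f' := fmap_iso (postcomp X g) u.

Definition rwhisk_iso (X Y Z : E) (g g' : hom Y Z) (u : g ≅ g') (f : hom X Y) :
  g · f ≅ g' · f := fmap_iso (precomp Z f) u.

End BicategoryOps.

Declare Scope iso_scope.
Delimit Scope iso_scope with iso.
Notation "v ∘ u" := (iso_comp v u) : iso_scope.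
Notation "g ◁ u" := (lwhisk_iso g u) : iso_scope.
Notation "u ▷ f" := (rwhisk_iso u f) : iso_scope.

Record PseudofunctorData (A B : Bicategory) := {
  pf_ob :> A -> B;
  pf_hom : forall X Y : A, Functor (hom X Y) (hom (pf_ob X) (pf_ob Y));
  pf_comp : forall (X Y Z : A) (g : hom Y Z) (f : hom X Y),
    pf_hom Y Z g · pf_hom X Y f ≅ pf_hom X Z (g · f);
  pf_id : forall X : A, id1 (pf_ob X) ≅ pf_hom X X (id1 X)
}.
Arguments pf_hom {A B} p {X Y}.
Arguments pf_comp {A B} p {X Y Z} g f.
Arguments pf_id {A B} p X.

Record IsPseudofunctor (A B : Bicategory) (F : PseudofunctorData A B) : Prop := {
  pf_comp_natl : forall (X Y Z : A) (g g' : hom Y Z) (f : hom X Y) (y : g ⇒ g'),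
    pf_comp F g' f ∘ (fmap (pf_hom F) y ▷ pf_hom F f)
    = fmap (pf_hom F) (y ▷ f) ∘ pf_comp F g f;
  pf_comp_natr : forall (X Y Z : A) (g : hom Y Z) (f f' : hom X Y) (x : f ⇒ f'),
    pf_comp F g f' ∘ (pf_hom F g ◁ fmap (pf_hom F) x)
    = fmap (pf_hom F) (g ◁ x) ∘ pf_comp F g f;
  pf_assoc : forall (W X Y Z : A) (h : hom Y Z) (g : hom X Y) (f : hom W X),
    fmap (pf_hom F) (assoc h g f) ∘ pf_comp F (h · g) f ∘ (pf_comp F h g ▷ pf_hom F f)
    = pf_comp F h (g · f) ∘ (pf_hom F h ◁ pf_comp F g f)
      ∘ assoc (pf_hom F h) (pf_hom F g) (pf_hom F f);
  pf_lunit : forall (X Y : A) (f : hom X Y),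
    fmap (pf_hom F) (lunit f) ∘ pf_comp F (id1 Y) f ∘ (pf_id F Y ▷ pf_hom F f)
    = lunit (pf_hom F f);
  pf_runit : forall (X Y : A) (f : hom X Y),
    fmap (pf_hom F) (runit f) ∘ pf_comp F f (id1 X) ∘ (pf_hom F f ◁ pf_id F X)
    = runit (pf_hom F f)
}.

Record Pseudofunctor (A B : Bicategory) := {
  pf_data :> PseudofunctorData A B;
  pf_laws : IsPseudofunctor pf_data
}.

(** In the axioms below the structural isomorphisms left implicit in the literature
    ([assoc], [runit]) are inserted explicitly. *)
Record RelPseudomonadData (A E : Bicategory) (J : Pseudofunctor A E) := {
  rpm_ob :> A -> E;
  rpm_ext : forall X Y : A, Functor (hom (J X) (rpm_ob Y)) (hom (rpm_ob X) (rpm_ob Y));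
  rpm_i : forall X : A, hom (J X) (rpm_ob X);
  rpm_mu : forall (X Y Z : A) (g : hom (J Y) (rpm_ob Z)) (f : hom (J X) (rpm_ob Y)),
    rpm_ext X Z (rpm_ext Y Z g · f) ≅ rpm_ext Y Z g · rpm_ext X Y f;
  rpm_eta : forall (X Y : A) (f : hom (J X) (rpm_ob Y)), f ≅ rpm_ext X Y f · rpm_i X;
  rpm_theta : forall X : A, rpm_ext X X (rpm_i X) ≅ id1 (rpm_ob X)
}.
Arguments rpm_ext {A E J} r {X Y}.
Arguments rpm_i {A E J} r X.
Arguments rpm_mu {A E J} r {X Y Z} g f.
Arguments rpm_eta {A E J} r {X Y} f.
Arguments rpm_theta {A E J} r X.

Record IsRelPseudomonad (A E : Bicategory) (J : Pseudofunctor A E)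
    (T : RelPseudomonadData J) : Prop := {
  rpm_mu_natl : forall (X Y Z : A) (g g' : hom (J Y) (T Z)) (f : hom (J X) (T Y))
      (y : g ⇒ g'),
    rpm_mu T g' f ∘ fmap (rpm_ext T) (fmap (rpm_ext T) y ▷ f)
    = (fmap (rpm_ext T) y ▷ rpm_ext T f) ∘ rpm_mu T g f;
  rpm_mu_natr : forall (X Y Z : A) (g : hom (J Y) (T Z)) (f f' : hom (J X) (T Y))
      (x : f ⇒ f'),
    rpm_mu T g f' ∘ fmap (rpm_ext T) (rpm_ext T g ◁ x)
    = (rpm_ext T g ◁ fmap (rpm_ext T) x) ∘ rpm_mu T g f;
  rpm_eta_nat : forall (X Y : A) (f f' : hom (J X) (T Y)) (x : f ⇒ f'),
    rpm_eta T f' ∘ x = (fmap (rpm_ext T) x ▷ rpm_i T X) ∘ rpm_eta T f;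
  rpm_assoc : forall (W X Y Z : A) (f : hom (J W) (T X)) (g : hom (J X) (T Y))
      (h : hom (J Y) (T Z)),
    assoc (rpm_ext T h) (rpm_ext T g) (rpm_ext T f)
      ∘ (rpm_mu T h g ▷ rpm_ext T f) ∘ rpm_mu T (rpm_ext T h · g) f
    = (rpm_ext T h ◁ rpm_mu T g f) ∘ rpm_mu T h (rpm_ext T g · f)
      ∘ fmap (rpm_ext T) (assoc (rpm_ext T h) (rpm_ext T g) f)
      ∘ fmap (rpm_ext T) (rpm_mu T h g ▷ f);
  rpm_unit : forall (X Y : A) (f : hom (J X) (T Y)),
    (rpm_ext T f ◁ rpm_theta T X) ∘ rpm_mu T f (rpm_i T X)
      ∘ fmap (rpm_ext T) (rpm_eta T f)
    = iso_inv (runit (rpm_ext T f))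
}.

Record RelPseudomonad (A E : Bicategory) (J : Pseudofunctor A E) := {
  rpm_data :> RelPseudomonadData J;
  rpm_laws : IsRelPseudomonad rpm_data
}.

Section PseudoAlgebras.
Variables (A E : Bicategory) (J : Pseudofunctor A E) (T : RelPseudomonad J).

Record PsAlgebra := {
  pa_ob :> E;
  pa_ext : forall X : A, Functor (hom (J X) pa_ob) (hom (T X) pa_ob);
  pa_hat : forall (X Y : A) (g : hom (J Y) pa_ob) (f : hom (J X) (T Y)),
    pa_ext X (pa_ext Y g · f) ≅ pa_ext Y g · rpm_ext T f;
  pa_tilde : forall (X : A) (f : hom (J X) pa_ob), f ≅ pa_ext X f · rpm_i T X;
  pa_hat_natl : forall (X Y : A) (g g' : hom (J Y) pa_ob) (f : hom (J X) (T Y))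
      (y : g ⇒ g'),
    pa_hat g' f ∘ fmap (pa_ext X) (fmap (pa_ext Y) y ▷ f)
    = (fmap (pa_ext Y) y ▷ rpm_ext T f) ∘ pa_hat g f;
  pa_hat_natr : forall (X Y : A) (g : hom (J Y) pa_ob) (f f' : hom (J X) (T Y))
      (x : f ⇒ f'),
    pa_hat g f' ∘ fmap (pa_ext X) (pa_ext Y g ◁ x)
    = (pa_ext Y g ◁ fmap (rpm_ext T) x) ∘ pa_hat g f;
  pa_tilde_nat : forall (X : A) (f f' : hom (J X) pa_ob) (x : f ⇒ f'),
    pa_tilde f' ∘ x = (fmap (pa_ext X) x ▷ rpm_i T X) ∘ pa_tilde f;
  pa_assoc : forall (X Y Z : A) (f : hom (J X) (T Y)) (g : hom (J Y) (T Z))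
      (h : hom (J Z) pa_ob),
    assoc (pa_ext Z h) (rpm_ext T g) (rpm_ext T f)
      ∘ (pa_hat h g ▷ rpm_ext T f) ∘ pa_hat (pa_ext Z h · g) f
    = (pa_ext Z h ◁ rpm_mu T g f) ∘ pa_hat h (rpm_ext T g · f)
      ∘ fmap (pa_ext X) (assoc (pa_ext Z h) (rpm_ext T g) f)
      ∘ fmap (pa_ext X) (pa_hat h g ▷ f);
  pa_unit : forall (X : A) (f : hom (J X) pa_ob),
    (pa_ext X f ◁ rpm_theta T X) ∘ pa_hat f (rpm_i T X) ∘ fmap (pa_ext X) (pa_tilde f)
    = iso_inv (runit (pa_ext X f))
}.
Arguments pa_ext p {X}.
Arguments pa_hat p {X Y} g f.
Arguments pa_tilde p {X} f.

Record PsMorphism (M N : PsAlgebra) := {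
  pm_cell :> hom (pa_ob M) (pa_ob N);
  pm_bar : forall (X : A) (f : hom (J X) M),
    pa_ext N (pm_cell · f) ≅ pm_cell · pa_ext M f;
  pm_bar_nat : forall (X : A) (f f' : hom (J X) M) (x : f ⇒ f'),
    pm_bar f' ∘ fmap (pa_ext N) (pm_cell ◁ x)
    = (pm_cell ◁ fmap (pa_ext M) x) ∘ pm_bar f;
  pm_hat : forall (X Y : A) (f : hom (J X) (T Y)) (g : hom (J Y) M),
    (pm_cell ◁ pa_hat M g f) ∘ pm_bar (pa_ext M g · f)
      ∘ fmap (pa_ext N) (assoc pm_cell (pa_ext M g) f) ∘ fmap (pa_ext N) (pm_bar g ▷ f)
    = assoc pm_cell (pa_ext M g) (rpm_ext T f)
      ∘ (pm_bar g ▷ rpm_ext T f) ∘ pa_hat N (pm_cell · g) f;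
  pm_tilde : forall (X : A) (f : hom (J X) M),
    assoc pm_cell (pa_ext M f) (rpm_i T X)
      ∘ (pm_bar f ▷ rpm_i T X) ∘ pa_tilde N (pm_cell · f)
    = pm_cell ◁ pa_tilde M f
}.
Arguments pm_bar {M N} p {X} f.

Record PsTransformation (M N : PsAlgebra) (h h' : PsMorphism M N) := {
  pt_cell :> pm_cell h ⇒ pm_cell h';
  pt_bar : forall (X : A) (f : hom (J X) M),
    pm_bar h' f ∘ fmap (pa_ext N) (pt_cell ▷ f)
    = (pt_cell ▷ pa_ext M f) ∘ pm_bar h f
}.

End PseudoAlgebras.
Arguments pa_ext {A E J T} p {X}.
Arguments pa_hat {A E J T} p {X Y} g f.
Arguments pa_tilde {A E J T} p {X} f.
Arguments pm_bar {A E J T M N} p {X} f.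

Section Reassoc.
Variable C : Category.

Lemma reassoc (a b c d : C) (y : b ⇒ c) (x : a ⇒ b) (z : a ⇒ c) :
  y ∘ x = z -> forall w : d ⇒ a, y ∘ (x ∘ w) = z ∘ w.
Proof. by move=> <- w; rewrite vcompA. Qed.

Lemma reassoc3 (a b c d e : C) (z : c ⇒ d) (y : b ⇒ c) (x : a ⇒ b) (t : a ⇒ d) :
  z ∘ y ∘ x = t -> forall w : e ⇒ a, z ∘ (y ∘ (x ∘ w)) = t ∘ w.
Proof. by move=> <- w; rewrite !vcompA. Qed.

Lemma iso_cancel_l (a b c : C) (u : b ≅ c) (x y : a ⇒ b) : u ∘ x = u ∘ y -> x = y.
Proof.
move=> e; rewrite -(vcomp1m x) -(vcomp1m y) -(iso_invK u) !vcompA.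
by rewrite e.
Qed.

Lemma iso_cancel_r (a b c : C) (u : a ≅ b) (x y : b ⇒ c) : x ∘ u = y ∘ u -> x = y.
Proof.
move=> e; rewrite -(vcompm1 x) -(vcompm1 y) -(iso_morK u) -!vcompA.
by rewrite e.
Qed.

Lemma iso_invKr (a b c : C) (u : a ≅ b) (x : c ⇒ a) : iso_inv u ∘ (u ∘ x) = x.
Proof. by rewrite -vcompA iso_invK vcomp1m. Qed.

Lemma iso_morKr (a b c : C) (u : a ≅ b) (x : c ⇒ b) : u ∘ (iso_inv u ∘ x) = x.
Proof. by rewrite -vcompA iso_morK vcomp1m. Qed.

End Reassoc.

Section Coherence.
Variable E : Bicategory.

Lemma id_lwhisk_inj (X Y : E) (f f' : hom X Y) (x y : f ⇒ f') :
  id1 Y ◁ x = id1 Y ◁ y -> x = y.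
Proof.
move=> e; apply: (iso_cancel_r (u := lunit f)).
by rewrite -!lunit_nat e.
Qed.

Lemma id_rwhisk_inj (X Y : E) (f f' : hom X Y) (x y : f ⇒ f') :
  x ▷ id1 X = y ▷ id1 X -> x = y.
Proof.
move=> e; apply: (iso_cancel_r (u := runit f)).
by rewrite -!runit_nat e.
Qed.

Lemma lunit_comp (X Y Z : E) (g : hom Y Z) (f : hom X Y) :
  lunit (g · f) ∘ assoc (id1 Z) g f = lunit g ▷ f.
Proof.
apply: id_lwhisk_inj; rewrite lwhiskM.
apply: (iso_cancel_r (u := assoc (id1 Z) (id1 Z · g) f)).
apply: (iso_cancel_r (u := rwhisk_iso (assoc (id1 Z) (id1 Z) g) f)).
rewrite /= !vcompA -pentagon (reassoc (triangle _ _)) -assoc_natl.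
rewrite (reassoc (eq_sym (assoc_natm _ _ _))).
by rewrite vcompA -rwhiskM triangle.
Qed.

Lemma runit_comp (X Y Z : E) (g : hom Y Z) (f : hom X Y) :
  (g ◁ runit f) ∘ assoc g f (id1 X) = runit (g · f).
Proof.
apply: id_rwhisk_inj; rewrite rwhiskM.
apply: (iso_cancel_l (u := assoc g f (id1 X))).
rewrite (reassoc (assoc_natm _ _ _)) -!triangle lwhiskM !vcompA -pentagon.
by rewrite (reassoc (assoc_natr _ _ _)) vcompA.
Qed.

Lemma pentagon_inv (V W X Y Z : E) (k : hom Y Z) (h : hom X Y) (g : hom W X)
    (f : hom V W) :
  assoc (k · h) g f ∘ (iso_inv (assoc k h g) ▷ f)
  = iso_inv (assoc k h (g · f)) ∘ (k ◁ assoc h g f) ∘ assoc k (h · g) f.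
Proof.
apply: (iso_cancel_l (u := assoc k h (g · f))).
rewrite iso_morKr (reassoc (pentagon _ _ _ _)) !vcompA -rwhiskM iso_morK rwhisk1.
by rewrite vcompm1.
Qed.

Lemma pentagon_inv' (V W X Y Z : E) (k : hom Y Z) (h : hom X Y) (g : hom W X)
    (f : hom V W) :
  (assoc k h g ▷ f) ∘ iso_inv (assoc (k · h) g f) ∘ iso_inv (assoc k h (g · f))
  = iso_inv (assoc k (h · g) f) ∘ (k ◁ iso_inv (assoc h g f)).
Proof.
apply: (iso_cancel_r (u := iso_comp (assoc k h (g · f)) (assoc (k · h) g f))).
rewrite /= !vcompA iso_invKr iso_invK vcompm1 pentagon.
by rewrite -(vcompA (k ◁ _)) -lwhiskM iso_invK lwhisk1 vcomp1m iso_invKr.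
Qed.

Lemma assoc_inv_natl (W X Y Z : E) (h h' : hom Y Z) (g : hom X Y) (f : hom W X)
    (z : h ⇒ h') :
  iso_inv (assoc h' g f) ∘ (z ▷ (g · f)) = ((z ▷ g) ▷ f) ∘ iso_inv (assoc h g f).
Proof.
apply: (iso_cancel_r (u := assoc h g f)).
by rewrite !vcompA iso_invK vcompm1 -assoc_natl iso_invKr.
Qed.

Lemma assoc_inv_natm (W X Y Z : E) (h : hom Y Z) (g g' : hom X Y) (f : hom W X)
    (y : g ⇒ g') :
  iso_inv (assoc h g' f) ∘ (h ◁ (y ▷ f)) = ((h ◁ y) ▷ f) ∘ iso_inv (assoc h g f).
Proof.
apply: (iso_cancel_r (u := assoc h g f)).
by rewrite !vcompA iso_invK vcompm1 -assoc_natm iso_invKr.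
Qed.

Lemma assoc_inv_natr (W X Y Z : E) (h : hom Y Z) (g : hom X Y) (f f' : hom W X)
    (x : f ⇒ f') :
  iso_inv (assoc h g f') ∘ (h ◁ (g ◁ x)) = ((h · g) ◁ x) ∘ iso_inv (assoc h g f).
Proof.
apply: (iso_cancel_r (u := assoc h g f)).
by rewrite !vcompA iso_invK vcompm1 -assoc_natr iso_invKr.
Qed.

Lemma lunit_inv_nat (X Y : E) (f f' : hom X Y) (x : f ⇒ f') :
  iso_inv (lunit f') ∘ x = (id1 Y ◁ x) ∘ iso_inv (lunit f).
Proof.
apply: (iso_cancel_r (u := lunit f)).
by rewrite !vcompA iso_invK vcompm1 -lunit_nat iso_invKr.
Qed.

Lemma lunit_comp_inv (X Y Z : E) (g : hom Y Z) (f : hom X Y) :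
  assoc (id1 Z) g f ∘ (iso_inv (lunit g) ▷ f) = iso_inv (lunit (g · f)).
Proof.
apply: (iso_cancel_l (u := lunit (g · f))).
by rewrite (reassoc (lunit_comp _ _)) -rwhiskM !iso_morK rwhisk1.
Qed.

End Coherence.

Section PsAlgBicategory.
Variables (A E : Bicategory) (J : Pseudofunctor A E) (T : RelPseudomonad J).

Lemma PsTransformation_eq (M N : PsAlgebra T) (h h' : PsMorphism M N)
    (x y : PsTransformation h h') : pt_cell x = pt_cell y -> x = y.
Proof.
case: x y => [x Hx] [y Hy] /= e; rewrite e in Hx *.
by rewrite (proof_irrelevance _ Hx Hy).
Qed.

Section HomCategory.
Variables M N : PsAlgebra T.

Lemma pt_id_bar (h : PsMorphism M N) (X : A) (f : hom (J X) M) :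
  pm_bar h f ∘ fmap (pa_ext N) (idm (pm_cell h) ▷ f)
  = (idm (pm_cell h) ▷ pa_ext M f) ∘ pm_bar h f.
Proof. by rewrite !rwhisk1 fmap1 vcompm1 vcomp1m. Qed.

Definition pt_id (h : PsMorphism M N) : PsTransformation h h :=
  {| pt_cell := idm (pm_cell h); pt_bar := pt_id_bar h |}.

Lemma pt_comp_bar (h h' h'' : PsMorphism M N) (y : PsTransformation h' h'')
    (x : PsTransformation h h') (X : A) (f : hom (J X) M) :
  pm_bar h'' f ∘ fmap (pa_ext N) ((y ∘ x) ▷ f)
  = ((y ∘ x) ▷ pa_ext M f) ∘ pm_bar h f.
Proof.
by rewrite !rwhiskM fmapM (reassoc (pt_bar y f)) !vcompA pt_bar.
Qed.

Definition pt_comp (h h' h'' : PsMorphism M N) (y : PsTransformation h' h'')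
    (x : PsTransformation h h') : PsTransformation h h'' :=
  {| pt_cell := y ∘ x; pt_bar := pt_comp_bar y x |}.

Lemma pt_compA (h h' h'' h''' : PsMorphism M N) (z : PsTransformation h'' h''')
    (y : PsTransformation h' h'') (x : PsTransformation h h') :
  pt_comp (pt_comp z y) x = pt_comp z (pt_comp y x).
Proof. exact/PsTransformation_eq/vcompA. Qed.

Lemma pt_comp1m (h h' : PsMorphism M N) (x : PsTransformation h h') :
  pt_comp (pt_id h') x = x.
Proof. exact/PsTransformation_eq/vcomp1m. Qed.

Lemma pt_compm1 (h h' : PsMorphism M N) (x : PsTransformation h h') :
  pt_comp x (pt_id h) = x.
Proof. exact/PsTransformation_eq/vcompm1. Qed.

Definition PsAlg_hom : Category :=
  {| obj := PsMorphism M N; mor := @PsTransformation A E J T M N;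
     idm := pt_id; vcomp := pt_comp;
     vcompA := pt_compA; vcomp1m := pt_comp1m; vcompm1 := pt_compm1 |}.

Section IsoLift.
Variables (h h' : PsMorphism M N) (u : pm_cell h ≅ pm_cell h').
Hypothesis u_bar : forall (X : A) (f : hom (J X) M),
  pm_bar h' f ∘ fmap (pa_ext N) (u ▷ f) = (u ▷ pa_ext M f) ∘ pm_bar h f.

Lemma pt_inv_bar (X : A) (f : hom (J X) M) :
  pm_bar h f ∘ fmap (pa_ext N) (iso_inv u ▷ f)
  = (iso_inv u ▷ pa_ext M f) ∘ pm_bar h' f.
Proof.
apply: (iso_cancel_r (u := fmap_iso (pa_ext N) (rwhisk_iso u f))) => /=.
rewrite !vcompA -fmapM -rwhiskM iso_invK u_bar rwhisk1 fmap1 vcompm1.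
by rewrite -vcompA -rwhiskM iso_invK rwhisk1 vcomp1m.
Qed.

Definition pt_mor : PsTransformation h h' := {| pt_cell := u; pt_bar := u_bar |}.
Definition pt_inv : PsTransformation h' h :=
  {| pt_cell := iso_inv u; pt_bar := pt_inv_bar |}.

Lemma pt_invK : pt_comp pt_inv pt_mor = pt_id h.
Proof. exact/PsTransformation_eq/iso_invK. Qed.

Lemma pt_morK : pt_comp pt_mor pt_inv = pt_id h'.
Proof. exact/PsTransformation_eq/iso_morK. Qed.

Definition pt_iso : @Iso PsAlg_hom h h' :=
  @Build_Iso PsAlg_hom h h' pt_mor pt_inv pt_invK pt_morK.

End IsoLift.
End HomCategory.

Section Identity.
Variable M : PsAlgebra T.

Definition pm_id_bar (X : A) (f : hom (J X) M) :
    pa_ext M (id1 (pa_ob M) · f) ≅ id1 (pa_ob M) · pa_ext M f :=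
  (isoV (lunit (pa_ext M f)) ∘ fmap_iso (pa_ext M) (lunit f))%iso.

Lemma pm_id_nat (X : A) (f f' : hom (J X) M) (x : f ⇒ f') :
  pm_id_bar f' ∘ fmap (pa_ext M) (id1 (pa_ob M) ◁ x)
  = (id1 (pa_ob M) ◁ fmap (pa_ext M) x) ∘ pm_id_bar f.
Proof.
rewrite /= !vcompA -fmapM lunit_nat fmapM.
by rewrite (reassoc (lunit_inv_nat _)) vcompA.
Qed.

Lemma pm_id_hat (X Y : A) (f : hom (J X) (T Y)) (g : hom (J Y) M) :
  (id1 (pa_ob M) ◁ pa_hat M g f) ∘ pm_id_bar (pa_ext M g · f)
    ∘ fmap (pa_ext M) (assoc (id1 (pa_ob M)) (pa_ext M g) f)
    ∘ fmap (pa_ext M) (pm_id_bar g ▷ f)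
  = assoc (id1 (pa_ob M)) (pa_ext M g) (rpm_ext T f)
    ∘ (pm_id_bar g ▷ rpm_ext T f) ∘ pa_hat M (id1 (pa_ob M) · g) f.
Proof.
rewrite /= !rwhiskM !vcompA (reassoc (lunit_comp_inv _ _)) -pa_hat_natl.
rewrite (reassoc (eq_sym (lunit_inv_nat _))) !vcompA -!fmapM.
by rewrite (reassoc (lunit_comp_inv _ _)) iso_morKr.
Qed.

Lemma pm_id_tilde (X : A) (f : hom (J X) M) :
  assoc (id1 (pa_ob M)) (pa_ext M f) (rpm_i T X)
    ∘ (pm_id_bar f ▷ rpm_i T X) ∘ pa_tilde M (id1 (pa_ob M) · f)
  = id1 (pa_ob M) ◁ pa_tilde M f.
Proof.
rewrite /= !rwhiskM !vcompA (reassoc (lunit_comp_inv _ _)) -pa_tilde_nat.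
by rewrite (reassoc (lunit_inv_nat _)) vcompA iso_invK vcompm1.
Qed.

Definition pm_id : PsMorphism M M :=
  {| pm_cell := id1 (pa_ob M); pm_bar := pm_id_bar; pm_bar_nat := pm_id_nat;
     pm_hat := pm_id_hat; pm_tilde := pm_id_tilde |}.

End Identity.

Section Composition.
Variables M N P : PsAlgebra T.
Implicit Types (h : PsMorphism M N) (k : PsMorphism N P).

Section Composite.
Variables (k : PsMorphism N P) (h : PsMorphism M N).

Definition pm_comp_bar (X : A) (f : hom (J X) M) :
    pa_ext P ((pm_cell k · pm_cell h) · f) ≅ (pm_cell k · pm_cell h) · pa_ext M f :=
  (isoV (assoc k h (pa_ext M f)) ∘ (pm_cell k ◁ pm_bar h f)
   ∘ pm_bar k (pm_cell h · f) ∘ fmap_iso (pa_ext P) (assoc k h f))%iso.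

Lemma pm_comp_nat (X : A) (f f' : hom (J X) M) (x : f ⇒ f') :
  pm_comp_bar f' ∘ fmap (pa_ext P) ((pm_cell k · pm_cell h) ◁ x)
  = ((pm_cell k · pm_cell h) ◁ fmap (pa_ext M) x) ∘ pm_comp_bar f.
Proof.
rewrite /= !vcompA -fmapM assoc_natr fmapM (reassoc (pm_bar_nat k _)) !vcompA.
rewrite -(vcompA (pm_cell k ◁ _)) -lwhiskM pm_bar_nat lwhiskM !vcompA.
by rewrite (reassoc (assoc_inv_natr _ _ _)) !vcompA.
Qed.

Lemma pm_comp_hat (X Y : A) (f : hom (J X) (T Y)) (g : hom (J Y) M) :
  ((pm_cell k · pm_cell h) ◁ pa_hat M g f) ∘ pm_comp_bar (pa_ext M g · f)
    ∘ fmap (pa_ext P) (assoc (pm_cell k · pm_cell h) (pa_ext M g) f)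
    ∘ fmap (pa_ext P) (pm_comp_bar g ▷ f)
  = assoc (pm_cell k · pm_cell h) (pa_ext M g) (rpm_ext T f)
    ∘ (pm_comp_bar g ▷ rpm_ext T f) ∘ pa_hat P ((pm_cell k · pm_cell h) · g) f.
Proof.
rewrite /= !rwhiskM !vcompA -pa_hat_natl (reassoc (pentagon_inv _ _ _ _)) !vcompA.
rewrite (reassoc (assoc_natm _ _ _)) !vcompA (reassoc3 (eq_sym (pm_hat k f _))) !vcompA.
rewrite -(vcompA (k ◁ _) (k ◁ _)) -lwhiskM -(vcompA (k ◁ _) (k ◁ _)) -lwhiskM.
rewrite !vcompA -pm_hat !lwhiskM !vcompA (reassoc (assoc_inv_natr _ _ _)) !vcompA.
rewrite (reassoc (eq_sym (pm_bar_nat k _))) !vcompA.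
rewrite (reassoc (eq_sym (pm_bar_nat k _))) !vcompA -!fmapM.
rewrite (reassoc (pentagon_inv _ _ _ _)) !vcompA iso_morKr.
by rewrite (reassoc (assoc_natm _ _ _)) !vcompA.
Qed.

Lemma pm_comp_tilde (X : A) (f : hom (J X) M) :
  assoc (pm_cell k · pm_cell h) (pa_ext M f) (rpm_i T X)
    ∘ (pm_comp_bar f ▷ rpm_i T X) ∘ pa_tilde P ((pm_cell k · pm_cell h) · f)
  = (pm_cell k · pm_cell h) ◁ pa_tilde M f.
Proof.
rewrite /= !rwhiskM !vcompA -pa_tilde_nat (reassoc (pentagon_inv _ _ _ _)) !vcompA.
rewrite (reassoc (assoc_natm _ _ _)) !vcompA (reassoc3 (pm_tilde k _)).
rewrite -(vcompA (k ◁ _) (k ◁ _)) -lwhiskM -(vcompA (k ◁ _) (k ◁ _)) -lwhiskM.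
rewrite !vcompA pm_tilde (reassoc (assoc_inv_natr _ _ _)) !vcompA iso_invK.
by rewrite vcompm1.
Qed.

Definition pm_comp : PsMorphism M P :=
  {| pm_cell := pm_cell k · pm_cell h; pm_bar := pm_comp_bar;
     pm_bar_nat := pm_comp_nat; pm_hat := pm_comp_hat; pm_tilde := pm_comp_tilde |}.

End Composite.

Lemma pt_lwhisk_bar k h h' (x : PsTransformation h h') (X : A) (f : hom (J X) M) :
  pm_bar (pm_comp k h') f ∘ fmap (pa_ext P) ((pm_cell k ◁ x) ▷ f)
  = ((pm_cell k ◁ x) ▷ pa_ext M f) ∘ pm_bar (pm_comp k h) f.
Proof.
rewrite /= !vcompA -fmapM assoc_natm fmapM (reassoc (pm_bar_nat k _)) !vcompA.
rewrite -(vcompA (k ◁ _) (k ◁ _)) -lwhiskM pt_bar lwhiskM !vcompA.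
by rewrite (reassoc (assoc_inv_natm _ _ _)) !vcompA.
Qed.

Definition pt_lwhisk k h h' (x : PsTransformation h h') :
    PsTransformation (pm_comp k h) (pm_comp k h') :=
  @Build_PsTransformation A E J T M P (pm_comp k h) (pm_comp k h')
    (pm_cell k ◁ x) (pt_lwhisk_bar k x).

Lemma pt_rwhisk_bar k k' (y : PsTransformation k k') h (X : A) (f : hom (J X) M) :
  pm_bar (pm_comp k' h) f ∘ fmap (pa_ext P) ((y ▷ pm_cell h) ▷ f)
  = ((y ▷ pm_cell h) ▷ pa_ext M f) ∘ pm_bar (pm_comp k h) f.
Proof.
rewrite /= !vcompA -fmapM assoc_natl fmapM (reassoc (pt_bar y _)) !vcompA.
rewrite (reassoc (eq_sym (interchange _ _))) !vcompA.
by rewrite (reassoc (assoc_inv_natl _ _ _)) !vcompA.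
Qed.

Definition pt_rwhisk k k' (y : PsTransformation k k') h :
    PsTransformation (pm_comp k h) (pm_comp k' h) :=
  @Build_PsTransformation A E J T M P (pm_comp k h) (pm_comp k' h)
    (y ▷ pm_cell h) (pt_rwhisk_bar y h).

End Composition.

Lemma pm_assoc_bar (M N P Q : PsAlgebra T) (m : PsMorphism P Q)
    (k : PsMorphism N P) (h : PsMorphism M N) (X : A) (f : hom (J X) M) :
  pm_bar (pm_comp m (pm_comp k h)) f
    ∘ fmap (pa_ext Q) (assoc (pm_cell m) (pm_cell k) (pm_cell h) ▷ f)
  = (assoc (pm_cell m) (pm_cell k) (pm_cell h) ▷ pa_ext M f)
    ∘ pm_bar (pm_comp (pm_comp m k) h) f.
Proof.
rewrite /= !lwhiskM !vcompA (reassoc (eq_sym (pm_bar_nat m _))) !vcompA.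
rewrite -!fmapM -pentagon.
rewrite (reassoc (eq_sym (assoc_inv_natr _ _ _))) !vcompA.
by rewrite (reassoc3 (pentagon_inv' _ _ _ _)) !vcompA.
Qed.

Definition pm_assoc (M N P Q : PsAlgebra T) (m : PsMorphism P Q)
    (k : PsMorphism N P) (h : PsMorphism M N) :
    @Iso (PsAlg_hom M Q) (pm_comp (pm_comp m k) h) (pm_comp m (pm_comp k h)) :=
  @pt_iso M Q (pm_comp (pm_comp m k) h) (pm_comp m (pm_comp k h))
    (assoc (pm_cell m) (pm_cell k) (pm_cell h)) (pm_assoc_bar m k h).

Lemma pm_lunit_bar (M N : PsAlgebra T) (h : PsMorphism M N) (X : A)
    (f : hom (J X) M) :
  pm_bar h f ∘ fmap (pa_ext N) (lunit (pm_cell h) ▷ f)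
  = (lunit (pm_cell h) ▷ pa_ext M f) ∘ pm_bar (pm_comp (pm_id N) h) f.
Proof.
rewrite /= !vcompA (reassoc (eq_sym (lunit_inv_nat _))) !vcompA -!fmapM lunit_comp.
by rewrite -(lunit_comp h (pa_ext M f)) !vcompA iso_morKr iso_morKr.
Qed.

Definition pm_lunit (M N : PsAlgebra T) (h : PsMorphism M N) :
    @Iso (PsAlg_hom M N) (pm_comp (pm_id N) h) h :=
  @pt_iso M N (pm_comp (pm_id N) h) h (lunit (pm_cell h)) (pm_lunit_bar h).

Lemma pm_runit_bar (M N : PsAlgebra T) (h : PsMorphism M N) (X : A)
    (f : hom (J X) M) :
  pm_bar h f ∘ fmap (pa_ext N) (runit (pm_cell h) ▷ f)
  = (runit (pm_cell h) ▷ pa_ext M f) ∘ pm_bar (pm_comp h (pm_id M)) f.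
Proof.
rewrite /= -!triangle fmapM (reassoc (pm_bar_nat h _)) !vcompA iso_morKr.
by rewrite -[RHS]vcompA -lwhiskM iso_morKr.
Qed.

Definition pm_runit (M N : PsAlgebra T) (h : PsMorphism M N) :
    @Iso (PsAlg_hom M N) (pm_comp h (pm_id M)) h :=
  @pt_iso M N (pm_comp h (pm_id M)) h (runit (pm_cell h)) (pm_runit_bar h).

Definition PsAlg : Bicategory.
Proof.
refine (@Build_Bicategory (PsAlgebra T) PsAlg_hom pm_id pm_comp pt_lwhisk
  (fun M N P k k' y h => pt_rwhisk y h) pm_assoc pm_lunit pm_runit
  _ _ _ _ _ _ _ _ _ _ _ _); move=> *; apply: PsTransformation_eq => /=.
- exact: lwhisk1.
- exact: lwhiskM.
- exact: rwhisk1.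
- exact: rwhiskM.
- exact: interchange.
- exact: assoc_natl.
- exact: assoc_natm.
- exact: assoc_natr.
- exact: lunit_nat.
- exact: runit_nat.
- exact: pentagon.
- exact: triangle.
Defined.

Definition forget_hom (M N : PsAlg) : Functor (hom M N) (hom (pa_ob M) (pa_ob N)) :=
  {| fobj := fun h : hom M N => pm_cell h;
     fmap := fun (h h' : hom M N) (x : h ⇒ h') => pt_cell x;
     fmap1 := fun h => eq_refl; fmapM := fun h h' h'' y x => eq_refl |}.

Definition forget_data : PseudofunctorData PsAlg E :=
  {| pf_ob := fun M : PsAlg => pa_ob M;
     pf_hom := forget_hom;
     pf_comp := fun (M N P : PsAlg) (k : hom N P) (h : hom M N) =>
       iso_id (pm_cell k · pm_cell h);
     pf_id := fun M : PsAlg => iso_id (id1 (pa_ob M)) |}.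

Lemma forget_laws : IsPseudofunctor forget_data.
Proof.
split=> *; rewrite /= ?lwhisk1 ?rwhisk1 ?vcompm1 ?vcomp1m //.
Qed.

Definition forget : Pseudofunctor PsAlg E :=
  {| pf_data := forget_data; pf_laws := forget_laws |}.

End PsAlgBicategory.

Section RelPseudoadjunctions.
Variables (A C E : Bicategory) (J : Pseudofunctor A E) (R : Pseudofunctor C E).

(** The functor [R(-) i] from [C[L,Y]] to [E[JX,RY]], for [i : JX -> RL]. *)
Definition transpose (X : A) (L : C) (i : hom (J X) (R L)) (Y : C) :
    Functor (hom L Y) (hom (J X) (R Y)) :=
  fcomp (precomp (R Y) i) (pf_hom R).

Record RelPseudoadjunction := {
  ra_ob : A -> C;
  ra_i : forall X : A, hom (J X) (R (ra_ob X));
  ra_equiv : forall (X : A) (Y : C), AdjointEquivalence (transpose (ra_i X) Y)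
}.

Variable adj : RelPseudoadjunction.
Local Notation L := (ra_ob adj).
Local Notation i := (ra_i adj).

Definition ra_sharp (X : A) (Y : C) : Functor (hom (J X) (R Y)) (hom (L X) Y) :=
  ladj (ra_equiv adj X Y).

Definition ra_eta (X : A) (Y : C) (f : hom (J X) (R Y)) :
    f ≅ pf_hom R (ra_sharp X Y f) · i X :=
  aunit (ra_equiv adj X Y) f.

Definition ra_eps (X : A) (Y : C) (h : hom (L X) Y) :
    ra_sharp X Y (pf_hom R h · i X) ≅ h :=
  acounit (ra_equiv adj X Y) h.

(** [(R(k) (R(h) i))^♯ ≅ (R(k h) i)^♯ ≅ k h] and, below, [i^♯ ≅ (R(1) i)^♯ ≅ 1]. *)
Definition ra_sharp_comp (X : A) (Y Z : C) (k : hom Y Z) (h : hom (L X) Y) :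
    ra_sharp X Z (pf_hom R k · (pf_hom R h · i X)) ≅ k · h :=
  (ra_eps (k · h)
   ∘ fmap_iso (ra_sharp X Z)
       ((pf_comp R k h ▷ i X) ∘ isoV (assoc (pf_hom R k) (pf_hom R h) (i X))))%iso.

Definition ra_sharp_id (X : A) : ra_sharp X (L X) (i X) ≅ id1 (L X) :=
  (ra_eps (id1 (L X))
   ∘ fmap_iso (ra_sharp X (L X)) ((pf_id R (L X) ▷ i X) ∘ isoV (lunit (i X))))%iso.

Definition induced_ext (X Y : A) :
    Functor (hom (J X) (R (L Y))) (hom (R (L X)) (R (L Y))) :=
  fcomp (pf_hom R) (ra_sharp X (L Y)).

Definition induced_mu (X Y Z : A) (g : hom (J Y) (R (L Z))) (f : hom (J X) (R (L Y))) :
    induced_ext X Z (induced_ext Y Z g · f) ≅ induced_ext Y Z g · induced_ext X Y f :=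
  (isoV (pf_comp R (ra_sharp Y (L Z) g) (ra_sharp X (L Y) f))
   ∘ fmap_iso (pf_hom R) (ra_sharp_comp (ra_sharp Y (L Z) g) (ra_sharp X (L Y) f))
   ∘ fmap_iso (induced_ext X Z) (induced_ext Y Z g ◁ ra_eta f))%iso.

Definition induced_theta (X : A) : induced_ext X X (i X) ≅ id1 (R (L X)) :=
  (isoV (pf_id R (L X)) ∘ fmap_iso (pf_hom R) (ra_sharp_id X))%iso.

(** All the laws of a relative pseudomonad are propositions, so an induced relative
    pseudomonad is compared with a given one through its data. *)
Definition induced : RelPseudomonadData J :=
  {| rpm_ob := fun X => R (L X); rpm_ext := induced_ext; rpm_i := i;
     rpm_mu := induced_mu; rpm_eta := fun X Y f => ra_eta f;
     rpm_theta := induced_theta |}.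

(** The extension of [X ↦ L X] to a pseudofunctor, with [L f = (i_Y Jf)^♯].  The
    constraint [L g L f ≅ L (g f)] is the inverse of
    [(i_Z J(g f))^♯ ≅ ((i_Z Jg) Jf)^♯ ≅ (R(L g) (i_Y Jf))^♯
     ≅ (R(L g) (R(L f) i_X))^♯ ≅ L g L f]. *)
Definition ra_left_hom (X Y : A) : Functor (hom X Y) (hom (L X) (L Y)) :=
  fcomp (ra_sharp X (L Y)) (fcomp (postcomp (J X) (i Y)) (pf_hom J)).

Definition ra_left_comp (X Y Z : A) (g : hom Y Z) (f : hom X Y) :
    ra_left_hom Y Z g · ra_left_hom X Y f ≅ ra_left_hom X Z (g · f) :=
  isoV (ra_sharp_comp (ra_left_hom Y Z g) (ra_left_hom X Y f)
    ∘ fmap_iso (ra_sharp X (L Z))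
        ((pf_hom R (ra_left_hom Y Z g) ◁ ra_eta (i Y · pf_hom J f))
         ∘ assoc (pf_hom R (ra_left_hom Y Z g)) (i Y) (pf_hom J f)
         ∘ (ra_eta (i Z · pf_hom J g) ▷ pf_hom J f)
         ∘ isoV (assoc (i Z) (pf_hom J g) (pf_hom J f))
         ∘ (i Z ◁ isoV (pf_comp J g f))))%iso.

Definition ra_left_id (X : A) : id1 (L X) ≅ ra_left_hom X X (id1 X) :=
  isoV (ra_sharp_id X
    ∘ fmap_iso (ra_sharp X (L X)) (runit (i X) ∘ (i X ◁ isoV (pf_id J X))))%iso.

Definition ra_left : PseudofunctorData A C :=
  {| pf_ob := L; pf_hom := ra_left_hom; pf_comp := ra_left_comp; pf_id := ra_left_id |}.

End RelPseudoadjunctions.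

(* Main.v *)
From Stdlib Require Import ssreflect ProofIrrelevance FunctionalExtensionality.
Require Import Defs.

Set Implicit Arguments.
Unset Strict Implicit.
Unset Printing Implicit Defensive.

(** The left adjoint sends [X] to the free pseudoalgebra on [X], which is [T X]
    with the extension, [μ] and [η] of [T] itself: at this object the axioms of a
    pseudoalgebra are those of [T].  The transpose of [f : JX -> M] is [f^a], made
    into a pseudomorphism by [â_{f,-}]; the unit of the adjunction is [ã_f], and its
    counit at [h : F X -> M] is

    [(h i)^a ⇒ h i^* ⇒ h 1 ≅ h],

    built from [h̄_i] and [θ].  The associativity axiom of [M] is one of the two
    axioms that make [f^a] a pseudomorphism, and the unit axiom of [M] is one of the
    two triangle identities.  What else the adjunction needs are three equations that
    the definitions of a relative pseudomonad and of a pseudoalgebra omit because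
    they follow from the associativity and unit axioms, as the corresponding ones
    for monoidal categories do:

    - [hat_tilde], [(â_{g,f} i) ∘ ã_{g^a f} = g^a η_f], makes [f^a] a pseudomorphism;
    - [theta_ext], [θ f^* ∘ μ_{i,f} = (θ f)^*], makes the counit a transformation;
    - [theta_eta], [θ i ∘ η_i = 1], gives the other triangle identity.

    Each is proved by applying a faithful functor, [(-)^a] or [i^* ◁ -] (faithful
    because [i^* ≅ 1] through [θ]), after which the axioms become applicable.

    The relative pseudomonad that this adjunction induces has the extension, [i] and
    [η] of [T] by construction; its [μ] reduces to that of [T] by the unit axiom
    ([free_mu]), and its [θ] because the two unitors agree on an identity 1-cell
    ([free_theta]).

    That [X ↦ F X] extends to a pseudofunctor holds for every relative
    pseudoadjunction.  The constraints of [L] are defined so that the 2-cells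
    [η : i_Y Jf ⇒ R(L f) i_X] form a pseudonatural transformation [i : J ⇒ R L];
    since [R(-) i_X] is faithful, an equation between 2-cells of [L] may be checked
    after pasting with these squares, where it turns into the corresponding law of
    [J]. *)

(** * Cancellation in categories and bicategories *)

Section Cancellation.

Lemma reassoc4 (C : Category) (a b c d e e' : C) (t : d ⇒ e) (z : c ⇒ d)
    (y : b ⇒ c) (x : a ⇒ b) (s : a ⇒ e) :
  t ∘ z ∘ y ∘ x = s -> forall w : e' ⇒ a, t ∘ (z ∘ (y ∘ (x ∘ w))) = s ∘ w.
Proof. by move=> <- w; rewrite !vcompA. Qed.

Lemma iso_eq (C : Category) (a b : C) (u v : a ≅ b) :
  iso_mor u = iso_mor v -> u = v.
Proof.
case: u v => [u u' uK Ku] [v v' vK Kv] /= e; subst v.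
have e' : u' = v'.
  by rewrite -(vcompm1 u') -Kv -vcompA uK vcomp1m.
subst v'; by rewrite (proof_irrelevance _ uK vK) (proof_irrelevance _ Ku Kv).
Qed.

Definition invertible (C : Category) (a b : C) (x : a ⇒ b) : Prop :=
  exists u : a ≅ b, iso_mor u = x.

Lemma invertible_epi (C : Category) (a b c : C) (x : a ⇒ b) (y z : b ⇒ c) :
  invertible x -> y ∘ x = z ∘ x -> y = z.
Proof. by case=> u <-; exact: iso_cancel_r. Qed.

Lemma lwhisk_iso_id_faithful (E : Bicategory) (X Y : E) (t : hom Y Y)
    (u : t ≅ id1 Y) (f f' : hom X Y) (x y : f ⇒ f') :
  t ◁ x = t ◁ y -> x = y.
Proof.
move=> e; apply: id_lwhisk_inj; apply: (iso_cancel_r (u := rwhisk_iso u f)).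
by rewrite /= -!interchange e.
Qed.

(** Whiskered with the identity, [λ] and [ρ] become the composites of the associator
    with [λ_{1·1}] and with [1 ◁ λ_1], which naturality of [λ] at [λ_1] identifies. *)
Lemma lunit_runit_id (E : Bicategory) (X : E) :
  iso_mor (lunit (id1 X)) = runit (id1 X).
Proof.
apply: id_rwhisk_inj; rewrite -lunit_comp -triangle.
congr (_ ∘ _); apply: (iso_cancel_l (u := lunit (id1 X))).
by rewrite lunit_nat.
Qed.

End Cancellation.

(** * The free pseudoalgebras and their adjunction *)

(** The proofs of functoriality are separated from the rest of the extension functors
    so that two sets of data with convertible object and morphism parts can be
    compared without transporting [μ], [η] and [θ] along an equality of functors. *)
Lemma rpm_data_eq (A E : Bicategory) (J : Pseudofunctor A E)
    (D : RelPseudomonadData J)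
    (ext1 : forall (X Y : A) (f : hom (J X) (D Y)),
      fmap (rpm_ext D) (idm f) = idm (rpm_ext D f))
    (extM : forall (X Y : A) (f f' f'' : hom (J X) (D Y)) (y : f' ⇒ f'') (x : f ⇒ f'),
      fmap (rpm_ext D) (y ∘ x) = fmap (rpm_ext D) y ∘ fmap (rpm_ext D) x)
    (mu : forall (X Y Z : A) (g : hom (J Y) (D Z)) (f : hom (J X) (D Y)),
      rpm_ext D (rpm_ext D g · f) ≅ rpm_ext D g · rpm_ext D f)
    (eta : forall (X Y : A) (f : hom (J X) (D Y)), f ≅ rpm_ext D f · rpm_i D X)
    (theta : forall X : A, rpm_ext D (rpm_i D X) ≅ id1 (D X)) :
  (forall X Y Z g f, mu X Y Z g f = rpm_mu D g f) ->
  (forall X Y f, eta X Y f = rpm_eta D f) ->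
  (forall X, theta X = rpm_theta D X) ->
  @Build_RelPseudomonadData A E J (rpm_ob D)
    (fun X Y => Build_Functor (ext1 X Y) (extM X Y)) (@rpm_i A E J D) mu eta theta = D.
Proof.
case: D ext1 extM mu eta theta => ob ext i mu' eta' theta' /=.
move=> ext1 extM mu eta theta emu eeta etheta.
have -> : ext1 = fun X Y f => fmap1 (ext X Y) f by apply: proof_irrelevance.
have -> : extM = fun X Y f f' f'' y x => fmapM (ext X Y) y x.
  by apply: proof_irrelevance.
have -> : mu = mu'.
  do 3 (apply: functional_extensionality_dep => ?).
  by do 2 (apply: functional_extensionality_dep => ?).
have -> : eta = eta' by do 3 (apply: functional_extensionality_dep => ?).
by have -> : theta = theta' by apply: functional_extensionality_dep.
Qed.

Section Free.
Variables (A E : Bicategory) (J : Pseudofunctor A E) (T : RelPseudomonad J).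

Section AlgebraLaws.
Variable M : PsAlgebra T.

(** [(-)^a i] is isomorphic to the identity through [ã]. *)
Lemma pa_ext_faithful (X : A) (f f' : hom (J X) M) (x y : f ⇒ f') :
  fmap (pa_ext M) x = fmap (pa_ext M) y -> x = y.
Proof.
move=> e; apply: (iso_cancel_l (u := pa_tilde M f')).
by rewrite !pa_tilde_nat e.
Qed.

Lemma pa_unitK (X : A) (f : hom (J X) M) :
  runit (pa_ext M f) ∘ (pa_ext M f ◁ rpm_theta T X) ∘ pa_hat M f (rpm_i T X)
    ∘ fmap (pa_ext M) (pa_tilde M f) = idm (pa_ext M f).
Proof. by rewrite pa_unit iso_morK. Qed.

End AlgebraLaws.

Definition free (X : A) : PsAlgebra T.
Proof.
refine {| pa_ob := T X; pa_ext := fun Y => @rpm_ext A E J T Y X;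
  pa_hat := fun Y Z g f => rpm_mu T g f; pa_tilde := fun Y f => rpm_eta T f |}.
- move=> *; exact: (rpm_mu_natl (rpm_laws T)).
- move=> *; exact: (rpm_mu_natr (rpm_laws T)).
- move=> *; exact: (rpm_eta_nat (rpm_laws T)).
- move=> *; exact: (rpm_assoc (rpm_laws T)).
- move=> *; exact: (rpm_unit (rpm_laws T)).
Defined.

(** After applying [(-)^a] and composing with the invertible
    [(g^a f^* i)^a ⇒ g^a (f^* i)^* ⇒ g^a f^* i^* ⇒ g^a f^*], both sides equal
    [â_{g,f}]: the right one by the unit law of [T], the left one by associativity of
    [M] at [g, f, i_X] and the unit law of [M] at [g^a f]. *)
Lemma hat_tilde (M : PsAlgebra T) (X Y : A) (f : hom (J X) (T Y)) (g : hom (J Y) M) :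
  assoc (pa_ext M g) (rpm_ext T f) (rpm_i T X) ∘ (pa_hat M g f ▷ rpm_i T X)
    ∘ pa_tilde M (pa_ext M g · f)
  = pa_ext M g ◁ rpm_eta T f.
Proof.
apply: pa_ext_faithful; apply: (iso_cancel_l (u := pa_hat M g (rpm_ext T f · rpm_i T X))).
apply: (iso_cancel_l (u := (pa_ext M g ◁ (runit (rpm_ext T f)
  ∘ (rpm_ext T f ◁ rpm_theta T X) ∘ rpm_mu T f (rpm_i T X)))%iso)).
rewrite /= pa_hat_natr -[RHS]vcompA -lwhiskM !vcompA.
rewrite (pa_unitK (M := free Y)) lwhisk1 vcomp1m.
(* The right-hand side is now [pa_hat M g f]. *)
rewrite !lwhiskM !fmapM !vcompA.
rewrite (reassoc4 (eq_sym (pa_assoc _ _ _))) !vcompA.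
rewrite (reassoc (eq_sym (assoc_natr _ _ _))) !vcompA.
rewrite (reassoc (runit_comp _ _)).
rewrite (reassoc (eq_sym (interchange _ _))) !vcompA.
rewrite (reassoc (runit_nat _)) !vcompA.
by rewrite pa_unitK vcompm1.
Qed.

(** After applying [i^* ◁ -] and precomposing with the invertible
    [(i^* f)^* ⇒ (i^* (i^* f))^* ⇒ i^* (i^* f)^*], both sides are [μ_{i,f}].  For the
    left one this is associativity of [T] at [i, i, f] followed by [i^* θ f^*], then the
    unit law at [i]; for the right one, naturality of [μ_{i,-}] and the unit law. *)
Lemma theta_ext (X Y : A) (f : hom (J X) (T Y)) :
  lunit (rpm_ext T f) ∘ (rpm_theta T Y ▷ rpm_ext T f) ∘ rpm_mu T (rpm_i T Y) f
  = fmap (rpm_ext T) (lunit f ∘ (rpm_theta T Y ▷ f)).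
Proof.
apply: (lwhisk_iso_id_faithful (rpm_theta T Y)).
set i := rpm_i T Y.
apply: (iso_cancel_r (u := (rpm_mu T i (rpm_ext T i · f)
   ∘ fmap_iso (rpm_ext T) (assoc (rpm_ext T i) (rpm_ext T i) f
   ∘ ((rpm_mu T i i ∘ fmap_iso (rpm_ext T) (rpm_eta T i)) ▷ f)))%iso)) => /=.
have nat := rpm_mu_natr (rpm_laws T).
rewrite (reassoc (eq_sym (nat _ _ _ _ _ _ _))) !vcompA -!fmapM.
rewrite !lwhiskM rwhiskM !vcompA (reassoc (eq_sym (assoc_natm _ _ _))) !vcompA.
rewrite (reassoc (triangle _ _)) -!rwhiskM.
rewrite (pa_unitK (M := free Y)) rwhisk1 fmap1 vcompm1 rwhiskM !fmapM.
rewrite (reassoc4 (eq_sym (rpm_assoc (rpm_laws T) _ _ _))) !vcompA.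
rewrite (rpm_mu_natl (rpm_laws T)).
rewrite (reassoc (eq_sym (assoc_natm _ _ _))) !vcompA.
rewrite (reassoc (triangle _ _)).
rewrite -[in LHS](vcompA _ _ (rpm_mu T i f)) -[in LHS](vcompA _ _ (rpm_mu T i f)).
rewrite -[in LHS](vcompA _ _ (rpm_mu T i f)) -!rwhiskM.
by rewrite (pa_unitK (M := free Y)) rwhisk1 vcomp1m.
Qed.

(** By [hat_tilde], [i^* ◁ (θ i ∘ η_i)] is [((i^* θ ∘ μ_{i,i}) i) ∘ η_{i^* i}].
    Naturality of [η] rewrites [η_{i^* i} ∘ η_i] as [((η_i)^* i) ∘ η_i], so that the
    precomposite with [η_i] is [η_i] by the unit law. *)
Lemma theta_eta (X : A) :
  lunit (rpm_i T X) ∘ (rpm_theta T X ▷ rpm_i T X) ∘ rpm_eta T (rpm_i T X)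
  = idm (rpm_i T X).
Proof.
apply: (lwhisk_iso_id_faithful (rpm_theta T X)).
set i := rpm_i T X.
apply: (iso_cancel_r (u := rpm_eta T i)).
rewrite lwhisk1 vcomp1m !lwhiskM -(hat_tilde (M := free X)) /= !vcompA.
rewrite (reassoc (eq_sym (assoc_natm _ _ _))) !vcompA.
rewrite (reassoc (triangle _ _)) (rpm_eta_nat (rpm_laws T)).
rewrite -!vcompA -!rwhiskM !vcompA.
by rewrite (pa_unitK (M := free X)) rwhisk1 vcomp1m.
Qed.

Section Transpose.
Variables (X : A) (M : PsAlgebra T).

Definition sharp_ob (f : hom (J X) M) : PsMorphism (free X) M.
Proof.
refine (@Build_PsMorphism A E J T (free X) M (pa_ext M f) (fun Y g => pa_hat M f g)
  _ _ _).
- move=> *; exact: pa_hat_natr.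
- move=> Y Z g g'; exact/eq_sym/pa_assoc.
- move=> Y g; exact: hat_tilde.
Defined.

Definition sharp_map (f f' : hom (J X) M) (x : f ⇒ f') :
  PsTransformation (sharp_ob f) (sharp_ob f').
Proof.
refine (@Build_PsTransformation A E J T (free X) M (sharp_ob f) (sharp_ob f')
  (fmap (pa_ext M) x) _).
move=> *; exact: pa_hat_natl.
Defined.

Definition sharp : Functor (hom (J X) M) (PsAlg_hom (free X) M).
Proof.
refine (@Build_Functor (hom (J X) M) (PsAlg_hom (free X) M) sharp_ob sharp_map _ _);
  move=> *; apply: PsTransformation_eq => /=.
- exact: fmap1.
- exact: fmapM.
Defined.

Definition eps_cell (h : PsMorphism (free X) M) :
    pa_ext M (pm_cell h · rpm_i T X) ≅ pm_cell h :=
  (runit (pm_cell h) ∘ (pm_cell h ◁ rpm_theta T X) ∘ pm_bar h (rpm_i T X))%iso.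

(** The compatibility of [h̄] with [μ_{i,g}] and its naturality at [θ g] reduce this to
    [theta_ext]. *)
Lemma eps_bar (h : PsMorphism (free X) M) (Y : A) (g : hom (J Y) (free X)) :
  pm_bar h g ∘ fmap (pa_ext M) (eps_cell h ▷ g)
  = (eps_cell h ▷ pa_ext (free X) g) ∘ pm_bar (sharp_ob (pm_cell h · rpm_i T X)) g.
Proof.
rewrite /= !rwhiskM !fmapM -!triangle !fmapM !vcompA.
rewrite -(vcompA (fmap _ (assoc _ _ _))) -fmapM assoc_natm fmapM !vcompA.
rewrite (reassoc (pm_bar_nat h _)) !vcompA (reassoc (pm_bar_nat h _)) !vcompA /=.
rewrite (reassoc (assoc_natm _ _ _)) !vcompA -(pm_hat h).
rewrite -!(vcompA (pm_cell h ◁ _)) -!lwhiskM /=.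
by rewrite -!fmapM -(theta_ext g) !lwhiskM !vcompA.
Qed.

Definition eps (h : PsMorphism (free X) M) :
    @Iso (PsAlg_hom (free X) M) (sharp_ob (pm_cell h · rpm_i T X)) h :=
  @pt_iso A E J T (free X) M (sharp_ob (pm_cell h · rpm_i T X)) h (eps_cell h)
    (eps_bar h).

Lemma eps_nat (h h' : PsMorphism (free X) M) (y : PsTransformation h h') :
  eps_cell h' ∘ fmap (pa_ext M) (y ▷ rpm_i T X) = y ∘ eps_cell h.
Proof.
rewrite /= !vcompA (pt_bar y) (reassoc (eq_sym (interchange _ _))) !vcompA.
by rewrite (reassoc (runit_nat _)) !vcompA.
Qed.

Lemma eps_triangle (h : PsMorphism (free X) M) :
  (eps_cell h ▷ rpm_i T X) ∘ pa_tilde M (pm_cell h · rpm_i T X)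
  = idm (pm_cell h · rpm_i T X).
Proof.
rewrite /= !rwhiskM -!triangle !vcompA (reassoc (assoc_natm _ _ _)) !vcompA.
rewrite (pm_tilde h) -!lwhiskM theta_eta.
exact: lwhisk1.
Qed.

Definition free_equiv :
  AdjointEquivalence (@transpose A (PsAlg T) E J (forget T) X (free X) (rpm_i T X) M).
Proof.
refine (@Build_AdjointEquivalence _ _
  (@transpose A (PsAlg T) E J (forget T) X (free X) (rpm_i T X) M)
  sharp (fun f => pa_tilde M f) eps _ _ _ _).
- move=> *; exact: pa_tilde_nat.
- move=> h h' y; apply: PsTransformation_eq; exact: eps_nat.
- move=> f; apply: PsTransformation_eq; rewrite /= !vcompA; exact: pa_unitK.
- move=> h; exact: eps_triangle.
Defined.

End Transpose.

Definition free_adj : RelPseudoadjunction J (forget T) :=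
  @Build_RelPseudoadjunction A (PsAlg T) E J (forget T) free (rpm_i T) free_equiv.

(** The counit at the composite [g^* f^*] contains [g^* μ_{f,i}] and [μ_{g,f^* i}].
    Naturality moves [(g^* η_f)^*] past the latter, leaving [μ_{g,f}] followed by
    [g^*] of the unit law at [f]. *)
Lemma free_mu (X Y Z : A) (g : hom (J Y) (T Z)) (f : hom (J X) (T Y)) :
  @induced_mu _ _ _ _ _ free_adj X Y Z g f = rpm_mu T g f.
Proof.
apply: iso_eq; rewrite /= /ra_eta /=.
rewrite vcomp1m rwhisk1 vcomp1m !vcompA -!fmapM iso_morKr.
rewrite (rpm_mu_natr (rpm_laws T)) (reassoc (eq_sym (assoc_inv_natr _ _ _))) !vcompA.
rewrite -runit_comp !vcompA iso_morKr -!vcompA -!lwhiskM.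
by rewrite !vcompA (pa_unitK (M := free Y)) lwhisk1 vcomp1m.
Qed.

Lemma free_theta (X : A) : induced_theta free_adj X = rpm_theta T X.
Proof.
apply: iso_eq => /=.
rewrite vcomp1m rwhisk1 vcomp1m !vcompA -!fmapM iso_morK fmap1 vcompm1.
by rewrite -lunit_inv_nat -lunit_runit_id iso_morKr.
Qed.

Lemma induced_free_adj : induced free_adj = rpm_data T.
Proof.
exact: (rpm_data_eq _ _ free_mu (fun X Y f => eq_refl) free_theta).
Qed.

End Free.

(** * Pasting of squares over a pseudofunctor *)

Section Squares.
Variables (C E : Bicategory) (R : Pseudofunctor C E).

(** A 2-cell filling the square with top [p], bottom [R k] and sides [i], [j]: a
    component of a pseudonatural transformation into [R] has this shape. *)
Definition Square (P Q : E) (X Y : C) (i : hom P (R X)) (j : hom Q (R Y))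
    (p : hom P Q) (k : hom X Y) : Type :=
  j · p ⇒ pf_hom R k · i.

Definition paste (P Q S : E) (X Y Z : C) (i : hom P (R X)) (j : hom Q (R Y))
    (l : hom S (R Z)) (q : hom Q S) (p : hom P Q) (k : hom Y Z) (h : hom X Y)
    (s : Square j l q k) (t : Square i j p h) : Square i l (q · p) (k · h) :=
  (pf_comp R k h ▷ i) ∘ iso_inv (assoc (pf_hom R k) (pf_hom R h) i)
    ∘ (pf_hom R k ◁ t) ∘ assoc (pf_hom R k) j p ∘ (s ▷ p) ∘ iso_inv (assoc l q p).

Definition id_square (P : E) (X : C) (i : hom P (R X)) : Square i i (id1 P) (id1 X) :=
  (pf_id R X ▷ i) ∘ iso_inv (lunit i) ∘ runit i.

Section Nat.
Variables (P Q S : E) (X Y Z : C) (i : hom P (R X)) (j : hom Q (R Y))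
    (l : hom S (R Z)).

Lemma paste_natl_top (q : hom Q S) (p : hom P Q) (k k' : hom Y Z) (h : hom X Y)
    (s : Square j l q k) (t : Square i j p h) (y : k ⇒ k') :
  (fmap (pf_hom R) (y ▷ h) ▷ i) ∘ paste s t
  = paste ((fmap (pf_hom R) y ▷ j) ∘ s : Square j l q k') t.
Proof.
rewrite /paste -!vcompA -rwhiskM -(pf_comp_natl (pf_laws R)) !rwhiskM !vcompA.
rewrite (reassoc (eq_sym (assoc_inv_natl _ _ _))) !vcompA.
by rewrite (reassoc (interchange _ _)) !vcompA (reassoc (eq_sym (assoc_natl _ _ _))) !vcompA.
Qed.

Lemma paste_natr_top (q : hom Q S) (p : hom P Q) (k : hom Y Z) (h h' : hom X Y)
    (s : Square j l q k) (t : Square i j p h) (x : h ⇒ h') :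
  (fmap (pf_hom R) (k ◁ x) ▷ i) ∘ paste s t
  = paste s ((fmap (pf_hom R) x ▷ i) ∘ t : Square i j p h').
Proof.
rewrite /paste -!vcompA -rwhiskM -(pf_comp_natr (pf_laws R)) !rwhiskM !vcompA.
rewrite (reassoc (eq_sym (assoc_inv_natm _ _ _))) !vcompA.
by rewrite !lwhiskM !vcompA.
Qed.

Lemma paste_natl_bot (q q' : hom Q S) (p : hom P Q) (k : hom Y Z) (h : hom X Y)
    (s : Square j l q k) (t : Square i j p h) (y : q' ⇒ q) :
  paste s t ∘ (l ◁ (y ▷ p)) = paste (s ∘ (l ◁ y) : Square j l q' k) t.
Proof.
by rewrite /paste !vcompA (assoc_inv_natm _ _ _) !rwhiskM !vcompA.
Qed.

Lemma paste_natr_bot (q : hom Q S) (p p' : hom P Q) (k : hom Y Z) (h : hom X Y)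
    (s : Square j l q k) (t : Square i j p h) (x : p' ⇒ p) :
  paste s t ∘ (l ◁ (q ◁ x)) = paste s (t ∘ (j ◁ x) : Square i j p' h).
Proof.
rewrite /paste !vcompA (assoc_inv_natr _ _ _) (reassoc (interchange _ _)) !vcompA.
by rewrite (reassoc (assoc_natr _ _ _)) !lwhiskM !vcompA.
Qed.

(** Pasting inherits its unit and associativity laws from [R]: this law and the next
    two move the constraints of [R] to the left end of the pasting, where [pf_lunit],
    [pf_runit] and [pf_assoc] apply; the rest is coherence of [E]. *)
Lemma paste_idl (q : hom P S) (k : hom X Z) (s : Square i l q k) :
  (fmap (pf_hom R) (lunit k) ▷ i) ∘ paste (id_square l) s = s ∘ (l ◁ lunit q).
Proof.
rewrite /paste /id_square !rwhiskM !vcompA.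
rewrite (reassoc (assoc_natl _ _ _)) !vcompA (reassoc (eq_sym (interchange _ _))) !vcompA.
rewrite (reassoc (assoc_inv_natl _ _ _)) -!vcompA -!rwhiskM !vcompA.
rewrite (pf_lunit (pf_laws R)) (reassoc (lunit_comp_inv _ _)).
rewrite (reassoc (eq_sym (lunit_inv_nat _))) -lunit_comp !vcompA iso_morKr iso_morKr.
by rewrite -triangle vcompA iso_morK vcompm1.
Qed.

Lemma paste_idr (q : hom P S) (k : hom X Z) (s : Square i l q k) :
  (fmap (pf_hom R) (runit k) ▷ i) ∘ paste s (id_square i) = s ∘ (l ◁ runit q).
Proof.
rewrite /paste /id_square !lwhiskM !vcompA.
rewrite (reassoc (assoc_inv_natm _ _ _)) -!vcompA -!rwhiskM !vcompA.
rewrite (pf_runit (pf_laws R)) -triangle !vcompA iso_morKr.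
rewrite -(vcompA (_ ◁ lunit i)) -lwhiskM iso_morK lwhisk1 vcomp1m.
rewrite (reassoc (runit_comp _ _)) (reassoc (runit_nat _)) -runit_comp !vcompA.
by rewrite iso_morK vcompm1.
Qed.

End Nat.

Lemma paste_assoc (P Q S S' : E) (X Y Z Z' : C) (i : hom P (R X)) (j : hom Q (R Y))
    (l : hom S (R Z)) (m : hom S' (R Z')) (r : hom S S') (q : hom Q S) (p : hom P Q)
    (n : hom Z Z') (k : hom Y Z) (h : hom X Y)
    (u : Square l m r n) (s : Square j l q k) (t : Square i j p h) :
  (fmap (pf_hom R) (assoc n k h) ▷ i) ∘ paste (paste u s) t
  = paste u (paste s t) ∘ (m ◁ assoc r q p).
Proof.
rewrite /paste !rwhiskM !lwhiskM !vcompA.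
rewrite (reassoc (assoc_natl _ _ _)) !vcompA (reassoc (eq_sym (interchange _ _))) !vcompA.
rewrite (reassoc (assoc_inv_natl _ _ _)) -!vcompA -!rwhiskM !vcompA.
rewrite (pf_assoc (pf_laws R)) !rwhiskM !vcompA; congr (_ ∘ _).
rewrite (reassoc (assoc_inv_natm _ _ _)) !vcompA; congr (_ ∘ _).
rewrite (reassoc (eq_sym (pentagon_inv' _ _ _ _))) !vcompA; congr (_ ∘ (_ ∘ _)).
rewrite (reassoc (assoc_inv_natr _ _ _)) !vcompA; congr (_ ∘ _).
rewrite (reassoc (pentagon_inv _ _ _ _)) !vcompA; congr (_ ∘ (_ ∘ _)).
rewrite (reassoc (assoc_natm _ _ _)) !vcompA; congr (_ ∘ _).
apply: (iso_cancel_l (u := lwhisk_iso (pf_hom R n) (assoc l q p))) => /=.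
rewrite (reassoc3 (eq_sym (pentagon _ _ _ _))) !vcompA.
rewrite -(vcompA _ _ (assoc (pf_hom R n) l _ ∘ _)) -lwhiskM iso_morK lwhisk1 vcomp1m.
rewrite (reassoc (assoc_natl _ _ _)) !vcompA; congr (_ ∘ (_ ∘ _)).
rewrite (reassoc (pentagon_inv _ _ _ _)) !vcompA.
by rewrite iso_morK vcompm1.
Qed.

Lemma paste_invertible (P Q S : E) (X Y Z : C) (i : hom P (R X)) (j : hom Q (R Y))
    (l : hom S (R Z)) (q : hom Q S) (p : hom P Q) (k : hom Y Z) (h : hom X Y)
    (s : Square j l q k) (t : Square i j p h) :
  invertible s -> invertible t -> invertible (paste s t).
Proof.
case=> u us [v vt].
exists ((pf_comp R k h ▷ i) ∘ isoV (assoc (pf_hom R k) (pf_hom R h) i)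
  ∘ (pf_hom R k ◁ v) ∘ assoc (pf_hom R k) j p ∘ (u ▷ p) ∘ isoV (assoc l q p))%iso.
by rewrite /= us vt.
Qed.

Lemma id_square_invertible (P : E) (X : C) (i : hom P (R X)) : invertible (id_square i).
Proof. by exists ((pf_id R X ▷ i) ∘ isoV (lunit i) ∘ runit i)%iso. Qed.

End Squares.

(** * Pseudofunctors from pseudonatural squares *)

Section TransportedLaws.
Variables (A C E : Bicategory) (J : Pseudofunctor A E) (R : Pseudofunctor C E).
Variables (L : PseudofunctorData A C) (i : forall X : A, hom (J X) (R (L X))).
Variable unit_square : forall (X Y : A) (f : hom X Y),
  Square (i X) (i Y) (pf_hom J f) (pf_hom L f).
Arguments unit_square {X Y} f.

Hypothesis transpose_faithful : forall (X : A) (Y : C) (h h' : hom (L X) Y) (x y : h ⇒ h'),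
  fmap (pf_hom R) x ▷ i X = fmap (pf_hom R) y ▷ i X -> x = y.
Hypothesis unit_square_invertible : forall (X Y : A) (f : hom X Y),
  invertible (unit_square f).
Hypothesis unit_square_nat : forall (X Y : A) (f f' : hom X Y) (x : f ⇒ f'),
  (fmap (pf_hom R) (fmap (pf_hom L) x) ▷ i X) ∘ unit_square f
  = unit_square f' ∘ (i Y ◁ fmap (pf_hom J) x).
Hypothesis unit_square_comp : forall (X Y Z : A) (g : hom Y Z) (f : hom X Y),
  (fmap (pf_hom R) (pf_comp L g f) ▷ i X) ∘ paste (unit_square g) (unit_square f)
  = unit_square (g · f) ∘ (i Z ◁ pf_comp J g f).
Hypothesis unit_square_id : forall X : A,
  (fmap (pf_hom R) (pf_id L X) ▷ i X) ∘ id_square (i X)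
  = unit_square (id1 X) ∘ (i X ◁ pf_id J X).

Lemma square_cancel (X Z : A) (p : hom (J X) (J Z)) (k h : hom (L X) (L Z))
    (s : Square (i X) (i Z) p k) (x y : k ⇒ h) :
  invertible s ->
  (fmap (pf_hom R) x ▷ i X) ∘ s = (fmap (pf_hom R) y ▷ i X) ∘ s -> x = y.
Proof. move=> s_inv e; apply: transpose_faithful; exact: invertible_epi e. Qed.

(** Each law of [L] is checked on the composite [R(-) i_X] after precomposing with a
    pasting of the invertible squares; pseudonaturality then moves both sides to the
    other end of the pasting, where they are the same law of [J]. *)
Lemma pseudofunctor_of_squares : IsPseudofunctor L.
Proof.
split.
- move=> X Y Z g g' f y.
  apply: (square_cancel (paste_invertible (unit_square_invertible g)
    (unit_square_invertible f))).
  rewrite 2!fmapM 2!rwhiskM 2!vcompA unit_square_comp.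
  rewrite paste_natl_top unit_square_nat -paste_natl_bot.
  rewrite (reassoc (unit_square_comp _ _)) (reassoc (unit_square_nat _)) !vcompA.
  by rewrite -!lwhiskM (pf_comp_natl (pf_laws J)).
- move=> X Y Z g f f' x.
  apply: (square_cancel (paste_invertible (unit_square_invertible g)
    (unit_square_invertible f))).
  rewrite 2!fmapM 2!rwhiskM 2!vcompA unit_square_comp.
  rewrite paste_natr_top unit_square_nat -paste_natr_bot.
  rewrite (reassoc (unit_square_comp _ _)) (reassoc (unit_square_nat _)) !vcompA.
  by rewrite -!lwhiskM (pf_comp_natr (pf_laws J)).
- move=> W X Y Z h g f.
  apply: (square_cancel (paste_invertible (paste_invertible (unit_square_invertible h)
    (unit_square_invertible g)) (unit_square_invertible f))).
  rewrite 4!fmapM 4!rwhiskM 4!vcompA.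
  rewrite paste_natl_top unit_square_comp -paste_natl_bot.
  rewrite (reassoc (unit_square_comp _ _)) vcompA (reassoc (unit_square_nat _)) vcompA.
  rewrite paste_assoc (reassoc (paste_natr_top _ _ _)) unit_square_comp.
  rewrite -paste_natr_bot vcompA (reassoc (unit_square_comp _ _)) vcompA.
  by rewrite -4!lwhiskM (pf_assoc (pf_laws J)).
- move=> X Y f.
  apply: (square_cancel (paste_invertible (id_square_invertible (i Y))
    (unit_square_invertible f))).
  rewrite paste_idl 2!fmapM 2!rwhiskM 2!vcompA.
  rewrite paste_natl_top unit_square_id -paste_natl_bot.
  rewrite (reassoc (unit_square_comp _ _)) vcompA (reassoc (unit_square_nat _)) vcompA.
  by rewrite -2!lwhiskM (pf_lunit (pf_laws J)).
- move=> X Y f.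
  apply: (square_cancel (paste_invertible (unit_square_invertible f)
    (id_square_invertible (i X)))).
  rewrite paste_idr 2!fmapM 2!rwhiskM 2!vcompA.
  rewrite paste_natr_top unit_square_id -paste_natr_bot.
  rewrite (reassoc (unit_square_comp _ _)) vcompA (reassoc (unit_square_nat _)) vcompA.
  by rewrite -2!lwhiskM (pf_runit (pf_laws J)).
Qed.

End TransportedLaws.

(** * The left pseudoadjoint is a pseudofunctor *)

Section LeftPseudoadjoint.
Variables (A C E : Bicategory) (J : Pseudofunctor A E) (R : Pseudofunctor C E).
Variable adj : RelPseudoadjunction J R.
Local Notation L := (ra_left adj).
Local Notation i := (ra_i adj).

Lemma transpose_faithful (X : A) (Y : C) (h h' : hom (ra_ob adj X) Y) (x y : h ⇒ h') :
  fmap (pf_hom R) x ▷ i X = fmap (pf_hom R) y ▷ i X -> x = y.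
Proof.
move=> e; apply: (iso_cancel_r (u := ra_eps h)).
have nat := acounit_nat (ra_equiv adj X Y).
by rewrite /ra_eps -!nat /= e.
Qed.

Lemma eta_nat (X : A) (Y : C) (f f' : hom (J X) (R Y)) (x : f ⇒ f') :
  (fmap (pf_hom R) (fmap (ra_sharp adj X Y) x) ▷ i X) ∘ ra_eta adj f = ra_eta adj f' ∘ x.
Proof. exact/eq_sym/(aunit_nat (ra_equiv adj X Y)). Qed.

Lemma eps_eta (X : A) (Y : C) (h : hom (ra_ob adj X) Y) :
  (fmap (pf_hom R) (ra_eps h) ▷ i X) ∘ ra_eta adj (pf_hom R h · i X) = idm _.
Proof. exact: (atriangle_r (ra_equiv adj X Y)). Qed.

(** The universal property of [η]: the transpose [ε ∘ x^♯] of [x] gives back [x].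
    The constraints of [L] are inverses of 2-cells of this form. *)
Lemma eta_factor (X : A) (Y : C) (a : hom (J X) (R Y)) (h : hom (ra_ob adj X) Y)
    (x : a ⇒ pf_hom R h · i X) :
  (fmap (pf_hom R) (ra_eps h ∘ fmap (ra_sharp adj X Y) x) ▷ i X) ∘ ra_eta adj a = x.
Proof. by rewrite fmapM rwhiskM vcompA eta_nat (reassoc (eps_eta _)) vcomp1m. Qed.

Definition unit_square (X Y : A) (f : hom X Y) :
    Square (R := R) (i X) (i Y) (pf_hom J f) (pf_hom L f) :=
  iso_mor (ra_eta adj (i Y · pf_hom J f)).

Lemma unit_square_nat (X Y : A) (f f' : hom X Y) (x : f ⇒ f') :
  (fmap (pf_hom R) (fmap (pf_hom L) x) ▷ i X) ∘ unit_square f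
  = unit_square f' ∘ (i Y ◁ fmap (pf_hom J) x).
Proof. exact: eta_nat. Qed.

Lemma unit_square_comp (X Y Z : A) (g : hom Y Z) (f : hom X Y) :
  (fmap (pf_hom R) (pf_comp L g f) ▷ i X) ∘ paste (unit_square g) (unit_square f)
  = unit_square (g · f) ∘ (i Z ◁ pf_comp J g f).
Proof.
have := @eta_factor X (L Z) (i Z · pf_hom J (g · f)) (pf_hom L g · pf_hom L f)
  (paste (unit_square g) (unit_square f) ∘ (i Z ◁ iso_inv (pf_comp J g f))).
have -> : ra_eps (pf_hom L g · pf_hom L f)
     ∘ fmap (ra_sharp adj X (L Z))
         (paste (unit_square g) (unit_square f) ∘ (i Z ◁ iso_inv (pf_comp J g f)))
   = iso_inv (pf_comp L g f).
  by rewrite /= /paste /unit_square !fmapM !vcompA.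
(* Generalizing the constraint keeps simplification from unfolding it. *)
move: (pf_comp L g f) => c e.
apply: (iso_cancel_r (u := i Z ◁ isoV (pf_comp J g f))%iso) => /=.
rewrite vcompA -[in LHS]e (reassoc (eq_sym (rwhiskM _ _ _))).
rewrite -fmapM iso_morK fmap1 rwhisk1 vcomp1m.
by rewrite vcompA -lwhiskM iso_morK lwhisk1 vcompm1.
Qed.

Lemma unit_square_id (X : A) :
  (fmap (pf_hom R) (pf_id L X) ▷ i X) ∘ id_square (i X)
  = unit_square (id1 X) ∘ (i X ◁ pf_id J X).
Proof.
have := @eta_factor X (L X) (i X · pf_hom J (id1 X)) (id1 (L X))
  (id_square (i X) ∘ (i X ◁ iso_inv (pf_id J X))).
have -> : ra_eps (id1 (L X))
     ∘ fmap (ra_sharp adj X (L X)) (id_square (i X) ∘ (i X ◁ iso_inv (pf_id J X)))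
   = iso_inv (pf_id L X).
  by rewrite /= /id_square !fmapM !vcompA.
move: (pf_id L X) => c e.
apply: (iso_cancel_r (u := i X ◁ isoV (pf_id J X))%iso) => /=.
rewrite vcompA -[in LHS]e (reassoc (eq_sym (rwhiskM _ _ _))).
rewrite -fmapM iso_morK fmap1 rwhisk1 vcomp1m.
by rewrite vcompA -lwhiskM iso_morK lwhisk1 vcompm1.
Qed.

Lemma unit_square_invertible (X Y : A) (f : hom X Y) : invertible (unit_square f).
Proof. by exists (ra_eta adj (i Y · pf_hom J f)). Qed.

Lemma ra_left_laws : IsPseudofunctor L.
Proof.
exact: (@pseudofunctor_of_squares A C E J R L (ra_i adj) unit_square transpose_faithful
  unit_square_invertible unit_square_nat unit_square_comp unit_square_id).
Qed.

End LeftPseudoadjoint.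

Theorem theorem3p21 : forall (A E : Bicategory) (J : Pseudofunctor A E)
    (T : RelPseudomonad J),
  exists F : RelPseudoadjunction J (forget T),
    IsPseudofunctor (ra_left F) /\ induced F = rpm_data T.
Proof.
move=> A E J T; exists (free_adj T); split.
- exact: ra_left_laws.
- exact: induced_free_adj.
Qed.
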